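(* Consider the scalar optimal control problem with isoperimetric constraints $(P_1)$: minimize $I[x(\cdot),u(\cdot)]=\int_a^b L(t,x(t),u(t))\,dt$ subject to $\dot x(t)=\varphi(t,x(t),u(t))$, $u(t)\in\Omega$, $\int_a^b g_i(t,x(t),u(t))\,dt=\xi_i$ for $i=1,\dots,k$, $\int_a^b g_j(t,x(t),u(t))\,dt\le \xi_j$ for $j=k+1,\dots,k+m$, $x(a)=\alpha$, $x(b)=\beta$. Put $g=(g_1,\dots,g_{k+m})$ and $$H(t,x,u,\psi_0,\psi,\lambda)=\psi_0L(t,x,u)+\psi\cdot\varphi(t,x,u)+\lambda\cdot g(t,x,u).$$ Suppose there exist $\varepsilon>0$ and a $C^2$-smooth one-parameter group of transformations $$h^s:[a,b]\times\mathbb{R}^n\times\mathbb{R}^r\to\mathbb{R}\times\mathbb{R}^n\times\mathbb{R}^r,\qquad h^s(t,x,u)=\bigl(T(t,x,u,s),X(t,x,u,s),U(t,x,u,s)\bigr),\quad s\in(-\varepsilon,\varepsilon),$$ with $h^0(t,x,u)=(t,x,u)$ for all $(t,x,u)\in[a,b]\times\mathbb{R}^n\times\mathbb{R}^r$, such that, for all $s\in(-\varepsilon,\varepsilon)$ and for every pair $(x(\cdot),u(\cdot))$ consisting of a piecewise-continuous control $u(\cdot)$ with values in $\Omega$ and a corresponding trajectory $x(\cdot)$ of $\dot x=\varphi(t,x,u)$, the following identities in $t$ hold on $[a,b]$: $$L(t,x(t),u(t))=L\circ h^s(t,x(t),u(t))\,\frac{d}{dt}T(t,x(t),u(t),s),$$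 $$\frac{d}{dt}X(t,x(t),u(t),s)=\varphi\circ h^s(t,x(t),u(t))\,\frac{d}{dt}T(t,x(t),u(t),s),$$ $$g(t,x(t),u(t))=g\circ h^s(t,x(t),u(t))\,\frac{d}{dt}T(t,x(t),u(t),s).$$ Then $$\psi(t)\cdot\frac{\partial}{\partial s}X(t,x(t),u(t),s)\Big|_{s=0}-H(t,x(t),u(t),\psi_0,\psi(t),\lambda)\,\frac{\partial}{\partial s}T(t,x(t),u(t),s)\Big|_{s=0}=\text{const}$$ is a conservation law for problem $(P_1)$; that is, for every Pontryagin extremal $(x(\cdot),u(\cdot),\psi_0,\psi(\cdot),\lambda)$ of $(P_1)$ the left-hand side is constant in $t\in[a,b]$.
   Context: Setting. $a<b$ are fixed real numbers, $\alpha,\beta\in\mathbb{R}^n$ and $\xi_1,\dots,\xi_{k+m}\in\mathbb{R}$ are given, and $\Omega\subseteq\mathbb{R}^r$ is a given set. The functions $L:\mathbb{R}\times\mathbb{R}^n\times\mathbb{R}^r\to\mathbb{R}$, $\varphi:\mathbb{R}\times\mathbb{R}^n\times\mathbb{R}^r\to\mathbb{R}^n$ and $g:\mathbb{R}\times\mathbb{R}^n\times\mathbb{R}^r\to\mathbb{R}^{k+m}$ are continuously differentiable with respect to all variables. Controls $u(\cdot)=(u_1(\cdot),\dots,u_r(\cdot))$ are piecewise-continuous functions on $[a,b]$ with values in $\Omega$, and $x(\cdot)=(x_1(\cdot),\dots,x_n(\cdot))$ is the corresponding state trajectory. The symbol $\frac{d}{dt}$ denotes the total derivative in $t$ along $(x(t),u(t))$,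 and $\frac{\partial}{\partial s}$ the partial derivative with respect to the parameter $s$. Pontryagin extremal of $(P_1)$. A quintuple $(x(\cdot),u(\cdot),\psi_0,\psi(\cdot),\lambda)$ satisfying the Pontryagin maximum principle for $(P_1)$: $(x(\cdot),u(\cdot))$ is an admissible pair (it satisfies the control system, the control constraint, the isoperimetric constraints and the boundary conditions); $\psi_0\le 0$ is a constant; $\psi(\cdot)$ is a continuous $n$-vector function on $[a,b]$ with piecewise-continuous derivative; $\lambda=(\lambda_1,\dots,\lambda_{k+m})$ is a constant vector; $(\psi_0,\psi(\cdot),\lambda)\ne 0$; and the following hold: (1) $\dot x(t)=\frac{\partial H}{\partial\psi}(t,x(t),u(t),\psi_0,\psi(t),\lambda)$ and $\dot\psi(t)=-\frac{\partial H}{\partial x}(t,x(t),u(t),\psi_0,\psi(t),\lambda)$; (2) $H(t,x(t),u(t),\psi_0,\psi(t),\lambda)=\max_{v\in\Omega}H(t,x(t),v,\psi_0,\psi(t),\lambda)$; (3) $\lambda_j\le 0$ for $j=k+1,\dots,k+m$, and $\lambda_j=0$ whenever $\int_a^b g_j(t,x(t),u(t))\,dt<\xi_j$; (4) $t\mapsto H(t,x(t),u(t),\psi_0,\psi(t),\lambda)$ is continuous and, on each interval of continuity of $u(\cdot)$, is differentiable with $\frac{dH}{dt}=\frac{\partial H}{\partial t}$ (both evaluated along the quintuple). Conservation law for $(P_1)$. An equation $C(t,x(t),u(t),\psi_0,\psi(t),\lambda)=\text{constant}$ valid in $t\in[a,b]$ for every quintuple $(x(\cdot),u(\cdot),\psi_0,\psi(\cdot),\lambda)$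 satisfying the Pontryagin maximum principle, i.e. every Pontryagin extremal.
   Formalization: The formal theorem also assumes that along every control pair U(t,x(t),u(t),s) lies in Ω for all small |s| (automatic if Ω is open); without it the claim fails, e.g. Ω={0}, L=x−u, φ=0, h^s=(t,x+s,u+s). *)

(* Defs.v *)
From HB Require Import structures.
From mathcomp Require Import all_boot all_order all_algebra.
From mathcomp Require Import all_classical all_reals all_analysis.

Set Implicit Arguments.
Unset Strict Implicit.
Unset Printing Implicit Defensive.

Import Order.TTheory GRing.Theory Num.Theory.
Import numFieldNormedType.Exports.

Local Open Scope classical_set_scope.
Local Open Scope ring_scope.

Section Calculus.
Context {R : realType}.

(* C^1 and C^2 in the Frechet sense; only used with O open *)
Definition C1_on {V W : normedModType R} (O : set V) (f : V -> W) : Prop :=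
  forall p, O p ->
    differentiable f p /\ forall v, {for p, continuous (fun q => 'D_v f q)}.

Definition C2_on {V W : normedModType R} (O : set V) (f : V -> W) : Prop :=
  C1_on O f /\ forall v, C1_on O (fun q => 'D_v f q).

(* C^2-smoothness on a set D that need not be open: f agrees on D with a C^2
   map defined on an open neighbourhood of D. *)
Definition C2_smooth_on {V W : normedModType R} (D : set V) (f : V -> W) :
    Prop :=
  exists (O : set V) (F : V -> W),
    [/\ open O, D `<=` O, {in D, F =1 f} & C2_on O F].

Definition dot {n : nat} (v w : 'rV[R]_n) : R := \sum_(i < n) v 0 i * w 0 i.

Definition grad {n : nat} (f : 'rV[R]_n -> R) (p : 'rV[R]_n) : 'rV[R]_n :=
  \row_(i < n) 'D_(delta_mx 0 i) f p.

Definition continuous_at_in (a b : R) {V : normedModType R} (f : R -> V)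
    (t : R) : Prop :=
  f @ within `[a, b] (nbhs t) --> f t.

(* l is the derivative of f at t relative to [a, b], hence the two-sided
   derivative at interior points and the one-sided derivative at a and at b *)
Definition has_deriv_in (a b : R) {V : normedModType R} (f : R -> V) (t : R)
    (l : V) : Prop :=
  (fun y => (y - t)^-1 *: (f y - f t)) @ within `[a, b] t^' --> l.

(* The value of f at a point of discontinuity is arbitrary. *)
Definition piecewise_continuous (a b : R) {V : normedModType R} (f : R -> V) :
    Prop :=
  [/\ exists s : seq R, forall t, t \in `[a, b] -> t \notin s ->
        continuous_at_in a b f t,
      forall t, a < t <= b -> cvg (f @ t^'-)
    & forall t, a <= t < b -> cvg (f @ t^'+)].

End Calculus.

(* points (t, x, u) *)
Notation txu R n r := (R * 'rV[R]_n * 'rV[R]_r)%type.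

Section OptimalControl.
Context {R : realType} {n r k m : nat}.

(* Data of the problem
     minimize  \int_a^b L (t, x(t), u(t)) dt
     subject to  x' = phi (t, x, u),  u(t) \in Omega,
       \int_a^b g_i (t, x(t), u(t)) dt  = xi_i   (the first k components),
       \int_a^b g_j (t, x(t), u(t)) dt <= xi_j   (the last m components),
       x(a) = alpha,  x(b) = beta. *)
Record iso_problem := IsoProblem {
  ta : R;
  tb : R;
  alpha : 'rV[R]_n;
  beta : 'rV[R]_n;
  xi : 'rV[R]_(k + m);
  Omega : set 'rV[R]_r;
  Lagr : txu R n r -> R;
  phi : txu R n r -> 'rV[R]_n;
  giso : txu R n r -> 'rV[R]_(k + m)
}.

Implicit Types (P : iso_problem) (x psi : R -> 'rV[R]_n) (u : R -> 'rV[R]_r).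
Implicit Types (lambda : 'rV[R]_(k + m)).

Definition cost P x u : R :=
  \int[lebesgue_measure]_(t in `[ta P, tb P]) Lagr P (t, x t, u t).

Definition iso_integral P x u (i : 'I_(k + m)) : R :=
  \int[lebesgue_measure]_(t in `[ta P, tb P]) giso P (t, x t, u t) 0 i.

(* A piecewise continuous control with values in Omega and a corresponding
   trajectory: x is continuous and satisfies the differential equation wherever
   u is continuous (x need not be differentiable at the jumps of u). *)
Definition control_pair P x u : Prop :=
  [/\ piecewise_continuous (ta P) (tb P) u,
      forall t, t \in `[ta P, tb P] -> Omega P (u t),
      {within `[ta P, tb P], continuous x}
    & forall t, t \in `[ta P, tb P] ->
        continuous_at_in (ta P) (tb P) u t ->
        has_deriv_in (ta P) (tb P) x t (phi P (t, x t, u t))].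

Definition admissible P x u : Prop :=
  [/\ control_pair P x u,
      forall i : 'I_k, iso_integral P x u (lshift m i) = xi P 0 (lshift m i),
      forall j : 'I_m, iso_integral P x u (rshift k j) <= xi P 0 (rshift k j),
      x (ta P) = alpha P
    & x (tb P) = beta P].

Definition Ham P (t : R) (y : 'rV[R]_n) (v : 'rV[R]_r)
    (psi0 : R) (p : 'rV[R]_n) lambda : R :=
  psi0 * Lagr P (t, y, v) + dot p (phi P (t, y, v))
  + dot lambda (giso P (t, y, v)).

(* The clauses involving a derivative in t are required at the points of
   continuity of u. *)
Definition extremal P x u (psi0 : R) psi lambda : Prop :=
  let a := ta P in let b := tb P in
  let ucont t := t \in `[a, b] /\ continuous_at_in a b u t in
  [/\ admissible P x u,
      psi0 <= 0,
      {within `[a, b], continuous psi} /\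
      (exists2 dpsi : R -> 'rV[R]_n, piecewise_continuous a b dpsi &
        exists s : seq R, forall t, t \in `[a, b] -> t \notin s ->
          has_deriv_in a b psi t (dpsi t)),
      ~ [/\ psi0 = 0, (forall t, t \in `[a, b] -> psi t = 0) & lambda = 0]
    & [/\ forall t, ucont t ->
            has_deriv_in a b x t
              (grad (fun p => Ham P t (x t) (u t) psi0 p lambda) (psi t)) /\
            has_deriv_in a b psi t
              (- grad (fun y => Ham P t y (u t) psi0 (psi t) lambda) (x t)),
          forall t, t \in `[a, b] -> forall v, Omega P v ->
            Ham P t (x t) v psi0 (psi t) lambda
            <= Ham P t (x t) (u t) psi0 (psi t) lambda,
          forall j : 'I_m,
            lambda 0 (rshift k j) <= 0 /\
            (iso_integral P x u (rshift k j) < xi P 0 (rshift k j) ->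
             lambda 0 (rshift k j) = 0),
          {within `[a, b], continuous
            (fun t => Ham P t (x t) (u t) psi0 (psi t) lambda)}
        & forall t, ucont t ->
            has_deriv_in a b
              (fun t' => Ham P t' (x t') (u t') psi0 (psi t') lambda) t
              (derive1 (fun t' => Ham P t' (x t) (u t) psi0 (psi t) lambda) t)]].

Definition conservation_law P
    (C : R -> 'rV[R]_n -> 'rV[R]_r -> R -> 'rV[R]_n -> 'rV[R]_(k + m) -> R) :
    Prop :=
  forall x u (psi0 : R) psi lambda, extremal P x u psi0 psi lambda ->
    exists c : R, forall t, t \in `[ta P, tb P] ->
      C t (x t) (u t) psi0 (psi t) lambda = c.

Definition Tcomp (h : R -> txu R n r -> txu R n r)
    t y v s : R := (h s (t, y, v)).1.1.
Definition Xcomp (h : R -> txu R n r -> txu R n r)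
    t y v s : 'rV[R]_n := (h s (t, y, v)).1.2.
Definition Ucomp (h : R -> txu R n r -> txu R n r)
    t y v s : 'rV[R]_r := (h s (t, y, v)).2.

(* h^s is only considered on [a, b] x R^n x R^r, from which it may exit; the
   group law is therefore the local one. *)
Definition C2_one_parameter_group (a b eps : R)
    (h : R -> txu R n r -> txu R n r) : Prop :=
  [/\ C2_smooth_on
        [set q : R * txu R n r |
          `|q.1| < eps /\ a <= q.2.1.1 <= b]
        (fun q => h q.1 q.2),
      forall p, a <= p.1.1 <= b -> h 0 p = p
    & forall s s' p, `|s| < eps -> `|s'| < eps -> `|s + s'| < eps ->
        a <= p.1.1 <= b -> a <= (h s' p).1.1 <= b ->
        h s (h s' p) = h (s + s') p].

(* The identities in t along all control pairs.  As for x' = phi in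
   control_pair, an equation with d/dt on [a, b] means that the differentiated
   functions T(t, x(t), u(t), s) and X(t, x(t), u(t), s) are continuous on
   [a, b], and are differentiable and satisfy the equation wherever u is
   continuous; dT is the value of the derivative of the former. *)
Definition invariant_under P (eps : R)
    (h : R -> txu R n r -> txu R n r) : Prop :=
  forall s, `|s| < eps -> forall x u, control_pair P x u ->
  let a := ta P in let b := tb P in
  let z t := (t, x t, u t) in
  let Ts t := Tcomp h t (x t) (u t) s in
  let Xs t := Xcomp h t (x t) (u t) s in
  [/\ {within `[a, b], continuous Ts},
      {within `[a, b], continuous Xs}
    & forall t, t \in `[a, b] -> continuous_at_in a b u t ->
      exists dT : R,
        [/\ has_deriv_in a b Ts t dT,
            Lagr P (z t) = Lagr P (h s (z t)) * dT,
            has_deriv_in a b Xs t (dT *: phi P (h s (z t)))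
          & giso P (z t) = dT *: giso P (h s (z t))]].

(* Along control pairs, h^s keeps the control in Omega for all small s (at each
   fixed t).  This holds automatically when Omega is open.  It is what makes
   s = 0 a local maximum of s |-> H(t, x(t), U(t, x(t), u(t), s), ...); the
   invariance identities alone do not imply the conservation law when Omega has
   boundary points. *)
Definition respects_control_constraint P
    (h : R -> txu R n r -> txu R n r) : Prop :=
  forall x u, control_pair P x u -> forall t, t \in `[ta P, tb P] ->
    \forall s \near (0 : R), Omega P (Ucomp h t (x t) (u t) s).

End OptimalControl.
Arguments iso_problem : clear implicits.

(* Main.v *)
(* The identities for T and X include continuity in t along every control pair.
   Changing the control at the single instant t to an arbitrary v in Omega gives
   another control pair with the same trajectory, so T(t, x(t), v, s) and
   X(t, x(t), v, s) do not depend on v in Omega.  With v frozen, the chain rule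
   in t applies to T and X along the trajectory, although u need not be
   differentiable in t.

   At a point t of continuity of u, put z = (t, x(t), u(t)) and
   K = psi_0 L + psi(t).phi + lambda.g.  The three identities combine into
     K(h^s z) dT/dt = psi_0 L(z) + lambda.g(z) + psi(t).dX/dt.
   Differentiate at s = 0.  The derivative of K(h^s z) has no contribution from
   U, because s = 0 is a local maximum of s |-> K(t, x(t), U).  By symmetry of
   second derivatives d/ds and d/dt commute on T and X, and the adjoint equation
   and dH/dt = H_t turn the result into: psi.X_s - H T_s has derivative 0 at t.
   This function is continuous on [a, b] and u has finitely many jumps, hence it
   is constant. *)

Require Import Defs.
From HB Require Import structures.
From mathcomp Require Import all_boot all_order all_algebra.
From mathcomp Require Import all_classical all_reals all_analysis.
From mathcomp Require Import ring.

Set Implicit Arguments.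
Unset Strict Implicit.
Unset Printing Implicit Defensive.

Import Order.TTheory GRing.Theory Num.Theory.
Import numFieldNormedType.Exports.

Local Open Scope classical_set_scope.
Local Open Scope ring_scope.

(** * Derivatives along curves and symmetry of second derivatives *)

Lemma is_derive_comp_diff (R : realType) (V W : normedModType R) (c : R -> V)
    (f : V -> W) (t : R) (w : V) :
  is_derive t 1 c w -> differentiable f (c t) ->
  is_derive t 1 (f \o c) ('D_w f (c t)).
Proof.
move=> [dc <-] df; have dc' := (derivable1_diffP c t).1 dc.
have dfc := differentiable_comp dc' df.
apply: DeriveDef; first exact: diff_derivable.
by rewrite (deriveE _ dfc) diff_comp //= (deriveE _ dc') (deriveE _ df).
Qed.

Lemma is_derive_line (R : realType) (V W : normedModType R) (f : V -> W)
    (p v : V) (s : R) :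
  differentiable f (p + s *: v) ->
  is_derive s 1 (fun s => f (p + s *: v)) ('D_v f (p + s *: v)).
Proof.
move=> df.
apply: (@is_derive_comp_diff _ _ _ (fun s : R => p + s *: v)) => //.
have := @is_deriveD _ _ _ (cst p) (fun s : R => s *: v) s 1 0 v.
rewrite add0r; apply.
apply/DeriveDef; first exact/derivable1_diffP.
by rewrite deriveE // diff_val/= scale1r.
Qed.

Lemma derive_linear (R : realType) (V W W' : normedModType R)
    (l : {linear W -> W'}) (f : V -> W) (p v : V) :
  continuous l -> differentiable f p -> 'D_v (l \o f) p = l ('D_v f p).
Proof.
move=> cl df; have dl := @linear_differentiable _ _ _ l (f p) cl.
rewrite !deriveE //; last exact: differentiable_comp.
by rewrite diff_comp //= diff_lin.
Qed.

Lemma continuous_is_derive1 (R : realType) (f df : R -> R) (a b : R) :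
  (forall s, s \in `[a, b] -> is_derive s 1 f (df s)) ->
  {within `[a, b], continuous f}.
Proof.
by move=> dfs; apply: derivable_within_continuous => s /dfs[].
Qed.

(** The mean value theorem is applied twice: along [v] to the increment of [l \o f] over [d *: w],
    then along [w] to the first derivative so obtained. The functional [l] makes the functions
    real-valued, as the theorem requires. *)
Lemma second_difference_MVT (R : realType) (V W : normedModType R) (O : set V)
    (l : {linear W -> R}) (f : V -> W) (p v w : V) (d : R) :
  continuous l -> C2_on O f -> 0 < d ->
  (forall s t, s \in `[0, d] -> t \in `[0, d] -> O (p + s *: v + t *: w)) ->
  exists s t, [/\ s \in `[0, d], t \in `[0, d] &
    l (f (p + d *: v + d *: w)) - l (f (p + d *: v))
      - (l (f (p + d *: w)) - l (f p))
    = l ('D_w (fun q => 'D_v f q) (p + s *: v + t *: w)) * d * d].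
Proof.
move=> cl [c1 c2] d0 Oin.
have d0' : 0 \in `[0, d] by rewrite in_itv /= lexx ltW.
have dd : d \in `[0, d] by rewrite in_itv /= lexx ltW.
have line (W' : normedModType R) (g : V -> W') (m : {linear W' -> R}) q z
    (s : R) :
    continuous m -> differentiable g (q + s *: z) ->
    is_derive s 1 (fun s => m (g (q + s *: z))) (m ('D_z g (q + s *: z))).
  move=> cm dg; rewrite -derive_linear //.
  apply: (@is_derive_line _ _ _ (m \o g)); apply: differentiable_comp => //.
  exact: linear_differentiable.
pose g s := l (f (p + d *: w + s *: v)) - l (f (p + s *: v)).
pose dg s := l ('D_v f (p + d *: w + s *: v)) - l ('D_v f (p + s *: v)).
have gP s : s \in `[0, d] -> is_derive s 1 g (dg s).
  move=> sd; apply: is_deriveB; apply: line => //.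
  - by rewrite addrAC; exact: (c1 _ (Oin _ _ sd dd)).1.
  - by have := (c1 _ (Oin _ _ sd d0')).1; rewrite scale0r addr0.
have /(MVT d0)[|s sd gE] := fun s sd => gP s (subset_itv_oo_cc sd).
  exact: continuous_is_derive1 gP.
have {}sd := subset_itv_oo_cc sd.
pose k t := l ('D_v f (p + s *: v + t *: w)).
pose dk t := l ('D_w (fun q => 'D_v f q) (p + s *: v + t *: w)).
have kP t : t \in `[0, d] -> is_derive t 1 k (dk t).
  move=> td; apply: line => //; exact: (c2 v _ (Oin _ _ sd td)).1.
have /(MVT d0)[|t td kE] := fun t td => kP t (subset_itv_oo_cc td).
  exact: continuous_is_derive1 kP.
exists s, t; split => //; first exact: subset_itv_oo_cc.
move: gE kE; rewrite /g /dg /k /dk !scale0r !addr0 !subr0.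
by rewrite ![p + _ *: w + _]addrAC => -> ->.
Qed.

(** Both groupings are the same second difference, so [x = y] after cancelling [d * d]; the rest is
    the triangle inequality through this common value. *)
Lemma second_difference_bound (R : realFieldType) (A B C D x y a b d e : R) :
  0 < d -> A - B - (C - D) = x * d * d -> A - C - (B - D) = y * d * d ->
  `|a - x| < e / 2 -> `|b - y| < e / 2 -> `|a - b| <= e.
Proof.
move=> d0 Ex Ey; have <- : x = y.
  apply/(mulIf (lt0r_neq0 d0))/(mulIf (lt0r_neq0 d0)); rewrite -Ex -Ey; ring.
by move=> ax bx; rewrite (splitr e) -(subrKA x) (le_trans (ler_normD _ _)) //
  ltW // ltrD // distrC.
Qed.

(** Schwarz's theorem, tested against [l]: the second difference over a small parallelogram at [p]
    equals [d * d] times either mixed derivative at nearby points, and both are continuous at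
    [p]. *)
Lemma derive_comm (R : realType) (V W : normedModType R) (O : set V)
    (l : {linear W -> R}) (f : V -> W) (p v w : V) :
  continuous l -> open O -> C2_on O f -> O p ->
  l ('D_w (fun q => 'D_v f q) p) = l ('D_v (fun q => 'D_w f q) p).
Proof.
move=> cl oO c2 Op; apply/eqP; rewrite -subr_eq0 -normr_le0.
apply/ler_addgt0Pl => e e0; rewrite addr0.
have lim y z : l ('D_y (fun q => 'D_z f q) q) @[q --> p] -->
    l ('D_y (fun q => 'D_z f q) p).
  apply: (cvg_comp _ _ ((c2.2 z p Op).2 y)); exact: cl.
have e20 : 0 < e / 2 by rewrite divr_gt0.
have near2 (g g' : V -> R) : g @ p --> g p -> g' @ p --> g' p ->
    \forall q \near p, [/\ O q, `|g p - g q| < e / 2 & `|g' p - g' q| < e / 2].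
  move=> /cvgrPdist_lt/(_ _ e20) A /cvgrPdist_lt/(_ _ e20) B.
  have nO : nbhs p O by apply: open_nbhs_nbhs; split.
  by apply: filterS3 nO A B => q Oq Aq Bq; split.
have /nbhs_normP[r /= r0 rP] := near2 _ _ (lim w v) (lim v w).
(* This size keeps the whole parallelogram strictly within distance [r] of [p]; the [+ 1] also
   covers [v = w = 0]. *)
pose d := r / (`|v| + `|w| + 1).
have n0 : 0 < `|v| + `|w| + 1 by rewrite ltr_wpDl // addr_ge0.
have d0 : 0 < d by rewrite divr_gt0.
have near_p s t : s \in `[0, d] -> t \in `[0, d] ->
    `|p - (p + s *: v + t *: w)| < r.
  rewrite !in_itv /= => /andP[s0 sd] /andP[t0 td].
  rewrite -addrA opprD addNKr normrN (le_lt_trans (ler_normD _ _)) //.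
  rewrite !normrZ !ger0_norm //.
  apply: (@le_lt_trans _ _ (d * (`|v| + `|w|))).
    by rewrite mulrDr lerD // ler_wpM2r.
  by rewrite /d mulrAC ltr_pdivrMr // ltr_pM2l // ltrDl.
have [s [t [sd td E1]]] := second_difference_MVT cl c2 d0
  (fun s t sd td => let: And3 Oq _ _ := rP _ (near_p s t sd td) in Oq).
have near_p' s' t' : s' \in `[0, d] -> t' \in `[0, d] ->
    `|p - (p + s' *: w + t' *: v)| < r.
  by move=> sd' td'; rewrite addrAC; exact: near_p.
have [s' [t' [sd' td' E2]]] := second_difference_MVT cl c2 d0
  (fun s t sd td => let: And3 Oq _ _ := rP _ (near_p' s t sd td) in Oq).
have [_ A _] := rP _ (near_p _ _ sd td).
have [_ _ B] := rP _ (near_p' _ _ sd' td').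
rewrite [p + d *: w + d *: v]addrAC in E2.
exact: second_difference_bound d0 E1 E2 A B.
Qed.

(** * Functions and controls on a segment *)

(** Induction on the exceptional points: an interior one splits the segment in two, and continuity
    of [f] joins the halves there. Without exceptional points this is the mean value theorem. *)
Lemma constant_of_derive0_finite (R : realType) (f : R -> R) (e : seq R)
    (a b : R) :
  a <= b -> {within `[a, b], continuous f} ->
  (forall t, t \in `]a, b[ -> t \notin e -> is_derive t 1 f 0) -> f a = f b.
Proof.
elim: e a b => [|c e IHe] a b ab cf df.
  have [|||t _] := @MVT_segment _ f (cst 0) a b => //.
    by move=> t tab; exact: df.
  by rewrite mul0r => /eqP; rewrite subr_eq0 => /eqP.
have [|cab] := boolP (c \in `]a, b[).
  rewrite in_itv /= => /andP[ac cb].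
  have cf1 : {within `[a, c], continuous f}.
    apply: continuous_subspaceW cf => y /=; rewrite !in_itv /=.
    by move=> /andP[-> /le_trans->//]; exact: ltW.
  have df1 t : t \in `]a, c[ -> t \notin e -> is_derive t 1 f 0.
    rewrite in_itv /= => /andP[at_ tc] te; apply: df.
      by rewrite in_itv /= at_ (lt_trans tc).
    by rewrite inE negb_or te (lt_eqF tc).
  have cf2 : {within `[c, b], continuous f}.
    apply: continuous_subspaceW cf => y /=; rewrite !in_itv /=.
    by move=> /andP[cy ->]; rewrite (le_trans (ltW ac) cy).
  have df2 t : t \in `]c, b[ -> t \notin e -> is_derive t 1 f 0.
    rewrite in_itv /= => /andP[ct tb] te; apply: df.
      by rewrite in_itv /= tb (lt_trans ac).
    by rewrite inE negb_or te (gt_eqF ct).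
  have E1 := IHe a c (ltW ac) cf1 df1.
  have E2 := IHe c b (ltW cb) cf2 df2.
  by rewrite E1 E2.
apply: (IHe a b ab cf) => t tab te; apply: df => //.
rewrite inE negb_or te andbT.
by apply: contraNneq cab => <-.
Qed.

(** Near an interior point the restriction to the segment is vacuous; the translation [y = h + t]
    then gives the usual difference quotient. *)
Lemma has_deriv_in_interior (R : realType) (V : normedModType R) (a b : R)
    (f : R -> V) (t : R) (l : V) :
  t \in `]a, b[ -> has_deriv_in a b f t l -> is_derive t 1 f l.
Proof.
move=> tab fl.
have nab : nbhs t `[a, b]%classic.
  apply: filterS (near_in_itvoo tab) => y; exact: subset_itv_oo_cc.
have {}fl : (y - t)^-1 *: (f y - f t) @[y --> t^'] --> l.
  apply: cvg_trans fl => U /=; rewrite /nbhs/= => UP.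
  rewrite /dnbhs /within /= in UP *.
  have {}UP : \forall y \near t, y != t -> `[a, b]%classic y ->
      U ((y - t)^-1 *: (f y - f t)) by exact: UP.
  near=> y => yt; apply: (near UP y) => //.
  by near: y.
have shift0 : shift t @ (0:R)^' --> t^'.
  have := @continuous_injective_withinNx R R (shift t) 0.
  rewrite /= add0r; apply.
    rewrite /prop_for /continuous_at /=.
    by apply: cvgD; [exact: cvg_id | exact: cvg_cst].
  by move=> y /(canRL (addrK _)); rewrite subrr.
have {shift0}fl := cvg_comp _ _ shift0 fl.
have : h^-1 *: ((f \o shift t) (h *: 1) - f t) @[h --> 0^'] --> l.
  apply: cvg_trans fl; apply: near_eq_cvg; near=> h => /=.
  by rewrite addrK [h *: 1]mulr1.
move=> fl'; apply: DeriveDef; first by apply/cvg_ex; exists l.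
exact/cvg_lim.
Unshelve. all: by end_near. Qed.

Lemma near_neq (R : realType) (t t0 : R) :
  t != t0 -> \forall y \near t, y != t0.
Proof. by move=> tt0; apply: open_nbhs_nbhs; split => //; exact: open_neq. Qed.

Lemma near_dnbhs_neq (R : realType) (t t0 : R) : \forall y \near t^', y != t0.
Proof.
have [->|tt0] := eqVneq t t0; first exact: nbhs_dnbhs_neq.
by apply: cvg_within; apply: near_neq.
Qed.

(** Since [a < b], every [t] of the segment is approached within it, from the right if [t < b] and
    from the left if [t = b]. Both values are then the limit of the same function. *)
Lemma continuous_at_in_unique (R : realType) (V : normedModType R) (a b : R)
    (f g : R -> V) (t : R) :
  a < b -> t \in `[a, b] -> (forall y, y != t -> f y = g y) ->
  continuous_at_in a b f t -> continuous_at_in a b g t -> f t = g t.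
Proof.
move=> ab; rewrite in_itv /= => /andP[at_ tb] fg cf cg.
have [tb'|bt] := ltP t b.
- have sub : t^'+ `=>` within `[a, b]%classic (nbhs t).
    move=> U UP; have {}UP : \forall y \near t^'+, `[a, b]%classic y -> U y.
      exact: (@cvg_within _ (nbhs t)).
    near=> y; apply: (near UP y) => //=.
    rewrite in_itv /= (le_trans at_) ?ltW //=; near: y; exact: nbhs_right_lt.
  have lf := cvg_trans (cvg_fmap2 sub) cf.
  have lg := cvg_trans (cvg_fmap2 sub) cg.
  apply: (cvg_unique (@norm_hausdorff _ V) lf).
  apply: cvg_trans lg; apply: near_eq_cvg; by near=> y; rewrite fg.
- have {bt}tb : t = b by apply/le_anti; rewrite tb bt.
  have sub : t^'- `=>` within `[a, b]%classic (nbhs t).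
    move=> U UP; have {}UP : \forall y \near t^'-, `[a, b]%classic y -> U y.
      exact: (@cvg_within _ (nbhs t)).
    near=> y; apply: (near UP y) => //=.
    rewrite in_itv /= -tb; apply/andP; split; last by near: y; exact: nbhs_left_le.
    by near: y; apply: nbhs_left_ge; rewrite tb.
  have lf := cvg_trans (cvg_fmap2 sub) cf.
  have lg := cvg_trans (cvg_fmap2 sub) cg.
  apply: (cvg_unique (@norm_hausdorff _ V) lf).
  apply: cvg_trans lg; apply: near_eq_cvg; by near=> y; rewrite fg.
Unshelve. all: by end_near. Qed.

(** * Changing a control at a single instant *)

Definition update (R : realType) (V : Type) (u : R -> V) (t0 : R) (v : V)
    (t : R) :=
  if t == t0 then v else u t.

Lemma near_update (R : realType) (V : Type) (u : R -> V) (t0 : R) (v : V)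
    (t : R) :
  \forall y \near t^', update u t0 v y = u y.
Proof.
by near=> y; rewrite /update ifN //; near: y; exact: near_dnbhs_neq.
Unshelve. all: by end_near. Qed.

Lemma continuous_at_in_update (R : realType) (V : normedModType R) (a b : R)
    (u : R -> V) (t0 : R) (v : V) (t : R) : t != t0 ->
  continuous_at_in a b (update u t0 v) t <-> continuous_at_in a b u t.
Proof.
move=> tt0; rewrite /continuous_at_in {2}/update (negPf tt0).
have e : \forall y \near within `[a, b]%classic (nbhs t), update u t0 v y = u y.
  apply: cvg_within; near=> y; rewrite /update ifN //; near: y.
  exact: near_neq.
split=> H; apply: cvg_trans H; apply: near_eq_cvg => //.
by apply: filterS e => y ->.
Unshelve. all: by end_near. Qed.

Lemma piecewise_continuous_update (R : realType) (V : normedModType R) (a b : R)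
    (u : R -> V) (t0 : R) (v : V) :
  piecewise_continuous a b u -> piecewise_continuous a b (update u t0 v).
Proof.
have e := near_update u t0 v.
move=> [[s sP] lP rP]; split.
- exists (t0 :: s) => t tab; rewrite inE negb_or => /andP[tt0 ts].
  exact/continuous_at_in_update/sP.
- move=> t /lP /cvg_ex[l ul]; apply/cvg_ex; exists l; apply: cvg_trans ul.
  apply: near_eq_cvg; near=> y; symmetry; near: y.
  have := e t; rewrite /at_left /dnbhs !near_withinE.
  by apply: filterS => y + yt; apply; rewrite lt_eqF.
- move=> t /rP /cvg_ex[l ul]; apply/cvg_ex; exists l; apply: cvg_trans ul.
  apply: near_eq_cvg; near=> y; symmetry; near: y.
  have := e t; rewrite /at_right /dnbhs !near_withinE.
  by apply: filterS => y + yt; apply; rewrite gt_eqF.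
Unshelve. all: by end_near. Qed.

(** The trajectory can stay the same because the differential equation is imposed only where the
    control is continuous, and the last hypothesis excludes [t0]. *)
Lemma control_pair_update (R : realType) (n r k m : nat)
    (P : iso_problem R n r k m) x u t0 v :
  control_pair P x u -> Omega P v ->
  ~ continuous_at_in (ta P) (tb P) (update u t0 v) t0 ->
  control_pair P x (update u t0 v).
Proof.
move=> [pu uO cx dx] Ov nc; split.
- exact: piecewise_continuous_update.
- by move=> t tab; rewrite /update; case: ifP => // _; exact: uO.
- exact: cx.
- move=> t tab; have [->|tt0] := eqVneq t t0; first by move=> /nc.
  rewrite continuous_at_in_update // => ct.
  by rewrite /update (negPf tt0); exact: dx.
Qed.

(** * The dot product *)

Section Dot.
Context {R : realType} {n : nat}.
Implicit Types p q w : 'rV[R]_n.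

Lemma dot_is_linear p : linear (dot p).
Proof.
move=> a v w; rewrite /dot scaler_sumr -big_split /=; apply: eq_bigr => i _.
by rewrite !mxE mulrDr mulrCA.
Qed.

HB.instance Definition _ p :=
  GRing.isLinear.Build R 'rV[R]_n R _ (dot p) (dot_is_linear p).

Lemma cvg_dot (T : Type) (F : set_system T) (f g : T -> 'rV[R]_n) p q :
  Filter F -> f @ F --> p -> g @ F --> q ->
  dot (f t) (g t) @[t --> F] --> dot p q.
Proof.
move=> FF fp gq; rewrite /dot; apply: cvg_big => [|i _]; first exact: add_continuous.
apply: cvgM.
- exact: (cvg_comp f (fun v => v 0 i) fp (@coord_continuous _ _ _ 0 i p)).
- exact: (cvg_comp g (fun v => v 0 i) gq (@coord_continuous _ _ _ 0 i q)).
Qed.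

Lemma continuous_dot p : continuous (dot p).
Proof.
move=> q; apply: (@cvg_dot _ (nbhs q) (cst p) id p q); last exact: cvg_id.
exact: cvg_cst.
Qed.

Lemma dotNl p q : dot (- p) q = - dot p q.
Proof. by rewrite /dot -sumrN; apply: eq_bigr => i _; rewrite mxE mulNr. Qed.

Lemma dotZr p a q : dot p (a *: q) = a * dot p q.
Proof. by rewrite /dot mulr_sumr; apply: eq_bigr => i _; rewrite mxE mulrCA. Qed.

Lemma is_derive_coord (V : normedModType R) (f : V -> 'rV[R]_n) t v df i :
  is_derive t v f df -> is_derive t v (fun y => f y 0 i) (df 0 i).
Proof.
move=> [d <-]; rewrite derive_mx // mxE; apply/derivableP.
exact: ((derivable_mxP f t v).1 d 0 i).
Qed.

Lemma is_derive_dot (f g : R -> 'rV[R]_n) (t : R) (df dg : 'rV[R]_n) :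
  is_derive t 1 f df -> is_derive t 1 g dg ->
  is_derive t 1 (fun y => dot (f y) (g y)) (dot df (g t) + dot (f t) dg).
Proof.
move=> fd gd.
rewrite (_ : (fun y => _) = \sum_(i < n) (fun y => f y 0 i * g y 0 i)); last first.
  by apply/funext => y; rewrite fct_sumE.
rewrite /dot -big_split /=; apply: is_derive_sum => i.
rewrite /= addrC [df 0 i * _]mulrC.
by apply: is_deriveM; exact: is_derive_coord.
Qed.

Lemma differentiable_dot (V : normedModType R) p (g : V -> 'rV[R]_n) t :
  differentiable g t -> differentiable (fun y => dot p (g y)) t.
Proof.
move=> dg; apply: (@differentiable_comp _ _ _ _ g (dot p)) => //.
by apply: linear_differentiable; exact: continuous_dot.
Qed.

End Dot.

(** * Curves in products *)

Lemma is_derive_linear (R : realType) (V W : normedModType R)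
    (l : {linear V -> W}) (c : R -> V) (t : R) (w : V) :
  continuous l -> is_derive t 1 c w -> is_derive t 1 (fun y => l (c y)) (l w).
Proof.
move=> cl dc.
have dl := @linear_differentiable _ _ _ l (c t) cl.
by have := is_derive_comp_diff dc dl; rewrite deriveE // diff_lin.
Qed.

(** The affine substitution [j] turns one difference quotient into the other before the limit is
    taken. This identifies partial derivatives with directional derivatives in the product space. *)
Lemma derive_affine (R : realType) (U V W : normedModType R) (f : V -> W)
    (j : U -> V) (y v : U) (w : V) :
  (forall s : R, j (s *: v + y) = s *: w + j y) ->
  'D_v (fun y => f (j y)) y = 'D_w f (j y).
Proof.
move=> jE; have E : (fun s : R => s^-1 *: (f (j (s *: v + y)) - f (j y))) =
    (fun s : R => s^-1 *: (f (s *: w + j y) - f (j y))).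
  by apply/funext => s; rewrite jE.
exact: (congr1 (fun g => lim (g @ (0 : R)^')) E).
Qed.

Lemma is_derive_pair (R : realType) (V W : normedModType R) (f : R -> V)
    (g : R -> W) (t : R) (v : V) (w : W) :
  is_derive t 1 f v -> is_derive t 1 g w ->
  is_derive t 1 (fun y => (f y, g y)) (v, w).
Proof.
move=> [df <-] [dg <-].
have df' := (derivable1_diffP f t).1 df.
have dg' := (derivable1_diffP g t).1 dg.
have dfg := differentiable_pair df' dg'.
apply: DeriveDef; first exact: diff_derivable.
by rewrite deriveE // diff_pair //= -!deriveE.
Qed.

Lemma cvg_pair_nbhs (T : Type) (U V : topologicalType) (F : set_system T)
    (f : T -> U) (g : T -> V) (p : U) (q : V) :
  Filter F -> f @ F --> p -> g @ F --> q -> (f t, g t) @[t --> F] --> (p, q).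
Proof. by move=> FF fp gq; exact: cvg_pair. Qed.

Lemma continuous_fst_fst (R : realType) (V1 V2 V3 : normedModType R) :
  continuous (fun q : V1 * V2 * V3 => q.1.1).
Proof. by move=> q; apply: cvg_comp; exact: cvg_fst. Qed.

Lemma continuous_snd_fst (R : realType) (V1 V2 V3 : normedModType R) :
  continuous (fun q : V1 * V2 * V3 => q.1.2).
Proof. move=> q; apply: cvg_comp; [exact: cvg_fst | exact: cvg_snd]. Qed.

Lemma continuous_snd (R : realType) (V1 V2 : normedModType R) :
  continuous (fun q : V1 * V2 => q.2).
Proof. move=> q; exact: cvg_snd. Qed.

Lemma is_derive_unique (R : realType) (V W : normedModType R) (f : V -> W)
    (t v : V) (a b : W) : is_derive t v f a -> is_derive t v f b -> a = b.
Proof. by move=> [_ <-] [_ <-]. Qed.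

Lemma is_derive_fst_fst (R : realType) (V1 V2 V3 : normedModType R)
    (c : R -> V1 * V2 * V3) (t : R) w :
  is_derive t 1 c w -> is_derive t 1 (fun y => (c y).1.1) w.1.1.
Proof.
exact: (@is_derive_linear R _ _ (fst \o fst) c t w (@continuous_fst_fst _ _ _ _)).
Qed.

Lemma is_derive_snd_fst (R : realType) (V1 V2 V3 : normedModType R)
    (c : R -> V1 * V2 * V3) (t : R) w :
  is_derive t 1 c w -> is_derive t 1 (fun y => (c y).1.2) w.1.2.
Proof.
exact: (@is_derive_linear R _ _ (snd \o fst) c t w (@continuous_snd_fst _ _ _ _)).
Qed.

Lemma is_derive_snd (R : realType) (V1 V2 : normedModType R)
    (c : R -> V1 * V2) (t : R) w :
  is_derive t 1 c w -> is_derive t 1 (fun y => (c y).2) w.2.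
Proof.
exact: (@is_derive_linear R _ _ snd c t w (@continuous_snd _ _ _)).
Qed.

Lemma pair_scaleD (R : pzRingType) (V W : lmodType R) (s : R) (a c : V)
    (b d : W) : s *: (a, b) + (c, d) = (s *: a + c, s *: b + d).
Proof. by []. Qed.

(** Prepares the splitting of a differential into its time, state and control parts, with the time
    part a multiple of the partial derivative in [t]. *)
Lemma triple_split (R : numFieldType) (V W : normedModType R) (a : R) (v : V)
    (w : W) :
  (a, v, w) = a *: (1, 0, 0) + (0, v, 0) + (0, 0, w).
Proof.
have ea : a = a * 1 + 0 + 0 by rewrite mulr1 !addr0.
have ev : v = a *: 0 + v + 0 by rewrite scaler0 add0r addr0.
have ew : w = a *: 0 + 0 + w by rewrite scaler0 !add0r.
exact: (congr2 pair (congr2 pair ea ev) ew).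
Qed.

Lemma derive_grad (R : realType) (n : nat) (f : 'rV[R]_n -> R) (p v : 'rV[R]_n) :
  differentiable f p -> 'D_v f p = dot (grad f p) v.
Proof.
move=> df; rewrite deriveE // {1}[v]row_sum_delta linear_sum /dot.
apply: eq_bigr => i _.
by rewrite linearZ /= mxE deriveE // mulrC.
Qed.

Lemma derive_comm_fst_fst (R : realType) (V W1 W2 : normedModType R) (O : set V)
    (f : V -> R * W1 * W2) (p v w : V) :
  open O -> C2_on O f -> O p ->
  ('D_w (fun q => 'D_v f q) p).1.1 = ('D_v (fun q => 'D_w f q) p).1.1.
Proof.
exact: (@derive_comm _ _ _ O (fst \o fst) f p v w (@continuous_fst_fst _ _ _ _)).
Qed.

Lemma derive_comm_dot (R : realType) (n : nat) (V W1 W2 : normedModType R)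
    (O : set V) (f : V -> W1 * 'rV[R]_n * W2) (p v w : V) (c : 'rV[R]_n) :
  open O -> C2_on O f -> O p ->
  dot c ('D_w (fun q => 'D_v f q) p).1.2 =
  dot c ('D_v (fun q => 'D_w f q) p).1.2.
Proof.
apply: (@derive_comm _ _ _ O (dot c \o (snd \o fst)) f p v w) => q.
exact: (cvg_comp _ _ (@continuous_snd_fst _ _ _ _ q) (@continuous_dot _ _ c _)).
Qed.

Lemma near0_norm_lt (R : realType) (e : R) :
  0 < e -> \forall s \near (0 : R), `|s| < e.
Proof. by move=> e0; apply/nbhs_normP; exists e => // s /=; rewrite sub0r normrN. Qed.

Lemma is_derive_const_add (R : realType) (V : normedModType R) (c : V)
    (f : R -> V) (t : R) (w : V) :
  is_derive t 1 f w -> is_derive t 1 (fun y => c + f y) w.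
Proof.
by move=> df; rewrite -[w]add0r; exact: (@is_deriveD _ _ _ (cst c) f t 1 0 w).
Qed.

Lemma is_derive_dotr (R : realType) (n : nat) (c : 'rV[R]_n)
    (f : R -> 'rV[R]_n) (t : R) (w : 'rV[R]_n) :
  is_derive t 1 f w -> is_derive t 1 (fun y => dot c (f y)) (dot c w).
Proof. exact: (@is_derive_linear _ _ _ (dot c) f t w (@continuous_dot _ _ c)). Qed.

Lemma pair_ext (T U : Type) (p q : T * U) : p.1 = q.1 -> p.2 = q.2 -> p = q.
Proof. by case: p q => [? ?] [? ?] /= -> ->. Qed.

(** * Invariance along a fixed extremal *)

Section Noether.
Context {R : realType} {n r k m : nat}.
Variables (P : iso_problem R n r k m) (eps : R) (h : R -> txu R n r -> txu R n r).
(** [F] stands for a C^2 extension of [h] to an open set. All derivatives are taken on [F], because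
    [h] is controlled only for [t] in the closed segment. *)
Variables (O : set (R * txu R n r)) (F : R * txu R n r -> txu R n r).
Hypotheses (hab : ta P < tb P) (heps : 0 < eps) (oO : open O) (F_C2 : C2_on O F).
Hypothesis domO : forall s t y v, `|s| < eps -> t \in `[ta P, tb P] ->
  O (s, (t, y, v)).
Hypothesis FE : forall s t y v, `|s| < eps -> t \in `[ta P, tb P] ->
  F (s, (t, y, v)) = h s (t, y, v).
Hypothesis h0 : forall t y v, t \in `[ta P, tb P] -> h 0 (t, y, v) = (t, y, v).
Hypothesis hOmega : respects_control_constraint P h.
Hypothesis hinv : invariant_under P eps h.

(** Along [u], and along [u] reset to [v] at [t], the T and X components are continuous at [t] and
    coincide elsewhere, so their values at [t] agree. *)
Lemma flow_control_indep x u s t v : control_pair P x u -> `|s| < eps ->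
  t \in `[ta P, tb P] -> Omega P v ->
  (F (s, (t, x t, u t))).1 = (F (s, (t, x t, v))).1.
Proof.
move=> cp seps tab Ov; have [_ _ cx _] := cp.
pose u' := update u t v.
have u'E y : y != t -> u' y = u y by rewrite /u' /update => /negPf ->.
have u't : u' t = v by rewrite /u' /update eqxx.
(* If u' is continuous at t, (x, u') may fail to be a control pair, but then
   continuity of F suffices. *)
have [cT cX] :
    continuous_at_in (ta P) (tb P) (fun y => Tcomp h y (x y) (u' y) s) t /\
    continuous_at_in (ta P) (tb P) (fun y => Xcomp h y (x y) (u' y) s) t.
  have [cu|ncu] := pselect (continuous_at_in (ta P) (tb P) u' t); last first.
    have [cT cX _] := hinv seps (control_pair_update cp Ov ncu).
    move: cT cX => /subspace_continuousP/(_ t tab) cT.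
    by move=> /subspace_continuousP/(_ t tab) cX.
  have cF : {for (s, (t, x t, u' t)), continuous F}.
    by apply: differentiable_continuous; exact: (F_C2.1 _ (domO _ _ seps tab)).1.
  have cz : (s, (y, x y, u' y)) @[y --> within `[ta P, tb P]%classic (nbhs t)] -->
      (s, (t, x t, u' t)).
    apply: cvg_pair_nbhs; first exact: cvg_cst.
    apply: cvg_pair_nbhs => //; apply: cvg_pair_nbhs.
      exact: cvg_within.
    by move/subspace_continuousP : cx; apply.
  have cFz := cvg_comp _ _ cz cF.
  have near_itv : \forall y \near within `[ta P, tb P]%classic (nbhs t),
      y \in `[ta P, tb P].
    exact: withinT.
  split; rewrite /continuous_at_in /Tcomp /Xcomp -FE //.
    apply: cvg_trans (cvg_comp _ _ cFz (@continuous_fst_fst _ _ _ _ _)).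
    by apply: near_eq_cvg; apply: filterS near_itv => y yab /=; rewrite FE.
  apply: cvg_trans (cvg_comp _ _ cFz (@continuous_snd_fst _ _ _ _ _)).
  by apply: near_eq_cvg; apply: filterS near_itv => y yab /=; rewrite FE.
have [/subspace_continuousP/(_ t tab) cT0 /subspace_continuousP/(_ t tab) cX0 _] :=
  hinv seps cp.
rewrite -u't !FE //.
have ET : Tcomp h t (x t) (u t) s = Tcomp h t (x t) (u' t) s.
  apply: (continuous_at_in_unique hab tab _ cT0 cT) => y /u'E; by move=> ->.
have EX : Xcomp h t (x t) (u t) s = Xcomp h t (x t) (u' t) s.
  apply: (continuous_at_in_unique hab tab _ cX0 cX) => y /u'E; by move=> ->.
by rewrite [LHS]surjective_pairing [RHS]surjective_pairing; congr (_, _).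
Qed.

(* The t-derivative of the flow along x with the control frozen at v; w stands
   for the derivative of x. *)
Definition flow_dt x (v : 'rV[R]_r) t (w : 'rV[R]_n) s : txu R n r :=
  'D_(0, (1, w, 0)) F (s, (t, x t, v)).

Lemma is_derive_flow_dt x w v s t : `|s| < eps -> t \in `]ta P, tb P[ ->
  is_derive t 1 x w ->
  is_derive t 1 (fun y => F (s, (y, x y, v))) (flow_dt x v t w s).
Proof.
move=> seps /subset_itv_oo_cc tab dx.
apply: (@is_derive_comp_diff _ _ _ (fun y => (s, (y, x y, v)))); last first.
  exact: (F_C2.1 _ (domO _ _ seps tab)).1.
by do 3! apply: is_derive_pair.
Qed.

(** By [flow_control_indep], T and X along [u] equal T and X with control [v] at all times near [t].
    Uniqueness of derivatives thus replaces the total derivatives in the invariance identities by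
    those with frozen control. *)
Lemma invariance_flow_dt x u v s t : control_pair P x u -> `|s| < eps ->
  t \in `]ta P, tb P[ -> continuous_at_in (ta P) (tb P) u t -> Omega P v ->
  let z := (t, x t, u t) in let d := (flow_dt x v t (phi P z) s).1 in
  [/\ Lagr P z = Lagr P (F (s, z)) * d.1, d.2 = d.1 *: phi P (F (s, z))
    & giso P z = d.1 *: giso P (F (s, z))].
Proof.
move=> cp seps tab cu Ov z d; have tab' := subset_itv_oo_cc tab.
have [_ _ _ dx] := cp.
have dxt := has_deriv_in_interior tab (dx t tab' cu).
have dF := is_derive_flow_dt v seps tab dxt.
have near_itv : \forall y \near t, y \in `[ta P, tb P].
  apply: filterS (near_in_itvoo tab) => y; exact: subset_itv_oo_cc.
have [_ _ /(_ t tab' cu)[dT [dTs EL dXs Eg]]] := hinv seps cp.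
have ET : dT = d.1.
  apply: is_derive_unique (is_derive_fst_fst dF).
  apply: near_eq_is_derive (has_deriv_in_interior tab dTs).
  apply: filterS near_itv => y yab.
  by rewrite /Tcomp -FE // (flow_control_indep cp seps yab Ov).
have EX : dT *: phi P (h s z) = d.2.
  apply: is_derive_unique (is_derive_snd_fst dF).
  apply: near_eq_is_derive (has_deriv_in_interior tab dXs).
  apply: filterS near_itv => y yab.
  by rewrite /Xcomp -FE // (flow_control_indep cp seps yab Ov).
by rewrite FE // -ET.
Qed.

Lemma flow_dt0 x w v t : t \in `]ta P, tb P[ -> is_derive t 1 x w ->
  (flow_dt x v t w 0).1.1 = 1.
Proof.
move=> tab dx; have e0 : `|0 : R| < eps by rewrite normr0.
apply: is_derive_unique (is_derive_fst_fst (is_derive_flow_dt v e0 tab dx)) _.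
apply: near_eq_is_derive (is_derive_id t 1).
apply: filterS (near_in_itvoo tab) => y /subset_itv_oo_cc yab.
by rewrite FE // h0.
Qed.

(** * The infinitesimal generator of the group, and the Hamiltonian along the flow *)

Definition flow_ds (z : txu R n r) : txu R n r := 'D_(1, 0) F (0, z).

Lemma is_derive_param (z : txu R n r) (s : R) :
  is_derive s 1 (fun s => (s, z)) (1, 0).
Proof. by apply: is_derive_pair. Qed.

Lemma is_derive_flow_ds t y v (s : R) : `|s| < eps -> t \in `[ta P, tb P] ->
  is_derive s 1 (fun s => F (s, (t, y, v))) ('D_(1, 0) F (s, (t, y, v))).
Proof.
move=> seps tab.
apply: (@is_derive_comp_diff _ _ _ (fun s => (s, (t, y, v)))).
  exact: is_derive_param.
exact: (F_C2.1 _ (domO _ _ seps tab)).1.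
Qed.

(** [Ham] as a function of the single point [z], so that it can be composed with the flow while the
    multipliers stay fixed. *)
Definition ham_fun (psi0 : R) (p : 'rV[R]_n) (lambda : 'rV[R]_(k + m))
    (z : txu R n r) :=
  psi0 * Lagr P z + dot p (phi P z) + dot lambda (giso P z).

Hypotheses (hL : C1_on setT (Lagr P)) (hphi : C1_on setT (phi P))
  (hg : C1_on setT (giso P)).

Lemma differentiable_ham_fun psi0 p lambda z :
  differentiable (ham_fun psi0 p lambda) z.
Proof.
have [dL _] := @hL z I; have [dphi _] := @hphi z I; have [dg _] := @hg z I.
apply: differentiableD; last exact: differentiable_dot.
apply: differentiableD; last exact: differentiable_dot.
by apply: differentiableM.
Qed.

(** The chain rule yields a time, a state and a control term; the maximum condition removes the
    last. *)
Lemma is_derive_ham_flow x u psi0 p lambda t : control_pair P x u ->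
  t \in `[ta P, tb P] ->
  (forall v, Omega P v ->
    Ham P t (x t) v psi0 p lambda <= Ham P t (x t) (u t) psi0 p lambda) ->
  let z := (t, x t, u t) in
  is_derive (0 : R) 1 (fun s => ham_fun psi0 p lambda (F (s, z)))
    ((flow_ds z).1.1 * derive1 (fun t' => Ham P t' (x t) (u t) psi0 p lambda) t +
     dot (grad (fun y => Ham P t y (u t) psi0 p lambda) (x t)) (flow_ds z).1.2).
Proof.
move=> cp tab hmax z; set K := ham_fun _ _ _; set d := flow_ds z.
have dK y : differentiable K y by exact: differentiable_ham_fun.
have e0 : `|0 : R| < eps by rewrite normr0.
have F0 : F (0, z) = z by rewrite FE // h0.
have := is_derive_comp_diff (is_derive_flow_ds (x t) (u t) e0 tab) (dK _).
rewrite -/z F0 -[X in 'D_X K z]/d; congr is_derive.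
have Et : 'D_((1, 0), 0) K z = derive1 (fun t' => Ham P t' (x t) (u t) psi0 p lambda) t.
  rewrite derive1E; symmetry.
  apply: (@derive_affine _ _ _ _ K (fun t' => (t', x t, u t))) => s.
  by rewrite !pair_scaleD !scaler0 !add0r.
have Ex : 'D_((0, d.1.2), 0) K z =
    dot (grad (fun y => Ham P t y (u t) psi0 p lambda) (x t)) d.1.2.
  rewrite -derive_grad; last first.
    apply: (@differentiable_comp _ _ _ _ (fun y => (t, y, u t)) K) => //.
    by do 2! apply: differentiable_pair => //.
  symmetry; apply: (@derive_affine _ _ _ _ K (fun y => (t, y, u t))) => s.
  by rewrite !pair_scaleD !scaler0 !add0r.
(* This is the derivative at 0 of [K (t, x t, U s)], where only the control moves; [s = 0] maximizes
   it as long as [U s] stays in [Omega P]. *)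
have Eu : 'D_((0, 0), d.2) K z = 0.
  pose U s := (F (s, z)).2.
  have dU (s : R) : `|s| < eps -> is_derive s 1 (fun s => K (t, x t, U s))
      ('D_((0, 0), ('D_(1, 0) F (s, z)).2) K (t, x t, U s)).
    move=> seps; apply: (@is_derive_comp_diff _ _ _ (fun s => (t, x t, U s))) => //.
    apply: is_derive_pair.
    exact: is_derive_snd (is_derive_flow_ds (x t) (u t) seps tab).
  have U0 : U 0 = u t by rewrite /U F0.
  have := dU 0 e0; rewrite U0 => dU0; apply: (is_derive_unique dU0).
  have /nbhs_normP[r0 /= r00 rP] := hOmega cp tab.
  (* Below [r0] the moved control is admissible; below [eps] the extension [F] agrees with [h] and
     is differentiable. *)
  pose r' := Num.min r0 eps.
  have r'0 : 0 < r' by rewrite lt_min r00.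
  have in_r s : s \in `](- r'), r'[ -> `|s| < r0 /\ `|s| < eps.
    by rewrite in_itv /= -ltr_norml lt_min => /andP[].
  apply: (@derive1_at_max _ _ (- r') r') => //.
  - by rewrite ltW // gt0_cp.
  - by move=> s /in_r[_ /dU[]].
  - by rewrite in_itv /= oppr_lt0 r'0.
  - move=> s /in_r[sr seps]; rewrite U0; apply: hmax.
    have := rP s; rewrite /= sub0r normrN => /(_ sr).
    by rewrite /Ucomp -FE.
have dE : d = d.1.1 *: (1, 0, 0) + (0, d.1.2, 0) + (0, 0, d.2).
  by rewrite -triple_split -!surjective_pairing.
rewrite deriveE // [in LHS]dE 2!linearD linearZ -!deriveE //.
by rewrite Et Ex Eu addr0.
Qed.

(** The two curves in [s] have equal T and X components for all [|s| < eps], hence equal derivatives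
    at 0. *)
Lemma flow_ds_control_indep x u t v : control_pair P x u ->
  t \in `[ta P, tb P] -> Omega P v ->
  (flow_ds (t, x t, u t)).1 = (flow_ds (t, x t, v)).1.
Proof.
move=> cp tab Ov; have e0 : `|0 : R| < eps by rewrite normr0.
have du := is_derive_flow_ds (x t) (u t) e0 tab.
have dv := is_derive_flow_ds (x t) v e0 tab.
have eqF : \forall s \near (0 : R),
    (F (s, (t, x t, u t))).1 = (F (s, (t, x t, v))).1.
  apply: filterS (near0_norm_lt heps) => s seps.
  exact: (flow_control_indep cp seps tab Ov).
apply: pair_ext.
  apply: is_derive_unique (is_derive_fst_fst dv).
  apply: near_eq_is_derive (is_derive_fst_fst du).
  by apply: filterS eqF => s ->.
apply: is_derive_unique (is_derive_snd_fst dv).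
apply: near_eq_is_derive (is_derive_snd_fst du).
by apply: filterS eqF => s ->.
Qed.

(** Only the generator has its control frozen at [v], which makes it differentiable along the
    trajectory. The Hamiltonian keeps [u], since the definition of an extremal supplies its
    derivative. *)
Lemma noether_derive0 x u psi0 psi lambda v t :
  extremal P x u psi0 psi lambda -> t \in `]ta P, tb P[ ->
  continuous_at_in (ta P) (tb P) u t -> Omega P v ->
  is_derive t 1 (fun y => dot (psi y) (flow_ds (y, x y, v)).1.2 -
    Ham P y (x y) (u y) psi0 (psi y) lambda * (flow_ds (y, x y, v)).1.1) 0.
Proof.
move=> [[cp _ _ _ _] _ _ _ [dxpsi hmax _ _ dH]] tab cu Ov.
have tab' := subset_itv_oo_cc tab.
have e0 : `|0 : R| < eps by rewrite normr0.
have [_ dpsi] := dxpsi t (conj tab' cu).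
have {}dpsi := has_deriv_in_interior tab dpsi.
have {}dH := has_deriv_in_interior tab (dH t (conj tab' cu)).
have [_ _ _ dx] := cp.
have {}dx := has_deriv_in_interior tab (dx t tab' cu).
set w := phi P (t, x t, u t) in dx.
(* [B'] differentiates first in [t] and then in [s], [S'] in the opposite order; the velocity [w] is
   held constant in both. *)
pose B' := 'D_(1, 0) (fun q => 'D_(0, (1, w, 0)) F q) (0, (t, x t, v)).
pose S' := 'D_(0, (1, w, 0)) (fun q => 'D_(1, 0) F q) (0, (t, x t, v)).
pose B s := flow_dt x v t w s.
have dB : is_derive (0 : R) 1 B B'.
  apply: (@is_derive_comp_diff _ _ _ (fun s => (s, (t, x t, v)))).
    exact: is_derive_param.
  exact: (F_C2.2 _ _ (domO _ _ e0 tab')).1.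
have dS : is_derive t 1 (fun y => flow_ds (y, x y, v)) S'.
  apply: (@is_derive_comp_diff _ _ _ (fun y => (0, (y, x y, v)))).
    by do 3! apply: is_derive_pair.
  exact: (F_C2.2 _ _ (domO _ _ e0 tab')).1.
have Oz := domO (x t) v e0 tab'.
have ES1 : S'.1.1 = B'.1.1 := derive_comm_fst_fst _ _ oO F_C2 Oz.
have ES2 : dot (psi t) S'.1.2 = dot (psi t) B'.1.2 :=
  derive_comm_dot _ _ _ oO F_C2 Oz.
have dA := is_derive_ham_flow cp tab' (hmax t tab').
set Ht := derive1 _ t in dA dH.
set Hx := grad _ _ in dA dpsi.
have dL := is_deriveM dA (is_derive_fst_fst dB).
pose C := psi0 * Lagr P (t, x t, u t) + dot lambda (giso P (t, x t, u t)).
have dR : is_derive (0 : R) 1 (fun s => C + dot (psi t) (B s).1.2)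
    (dot (psi t) B'.1.2).
  exact: is_derive_const_add (is_derive_dotr _ (is_derive_snd_fst dB)).
have F0 := etrans (FE (x t) (u t) e0 tab') (h0 (x t) (u t) tab').
have B0 : (B 0).1.1 = 1 := flow_dt0 v tab dx.
have BE s (seps : `|s| < eps) :
    [/\ Lagr P (t, x t, u t) = Lagr P (F (s, (t, x t, u t))) * (B s).1.1,
        (B s).1.2 = (B s).1.1 *: phi P (F (s, (t, x t, u t)))
      & giso P (t, x t, u t) = (B s).1.1 *: giso P (F (s, (t, x t, u t)))] :=
  invariance_flow_dt cp seps tab cu Ov.
have Eds := flow_ds_control_indep cp tab' Ov.
have dxi := is_derive_dot dpsi (is_derive_snd_fst dS).
have dtau := is_deriveM dH (is_derive_fst_fst dS).
clearbody B' S' B.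
(* The combined invariance identity differentiated at [s = 0]: H T_st + T_s H_t + H_x . X_s = psi .
   X_st. It uses that at [s = 0] the flow is the identity and dT/dt = 1. *)
have key : Ham P t (x t) (u t) psi0 (psi t) lambda * B'.1.1 +
    ((flow_ds (t, x t, v)).1.1 * Ht + dot Hx (flow_ds (t, x t, v)).1.2) =
    dot (psi t) B'.1.2.
  rewrite -Eds.
  apply: is_derive_unique dR; apply: near_eq_is_derive; last first.
    apply: is_derive_eq dL _; apply: congr2.
      exact: (congr1 (fun q => ham_fun psi0 (psi t) lambda q * B'.1.1) F0).
    exact: etrans (congr1 (fun q => q *: _) B0) (scale1r _).
  apply: filterS (near0_norm_lt heps) => s /BE[EL EX Eg].
  rewrite /C EX EL Eg fctE /= /ham_fun !dotZr; ring.
(* The product rule gives psi' . X_s + psi . X_st - H T_st - T_s H_t with psi' = - H_x, which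
   vanishes by [key]. *)
apply: is_derive_eq (is_deriveB dxi dtau) _.
rewrite ES1 ES2 -key dotNl -[X in _ - X]/(_ * _ + _ * _); ring.
Qed.

(** With one [v] for all times, [G] is continuous on the whole segment, even across the jumps of
    [u], and its derivative vanishes at the interior points outside the finite exceptional list of
    [u]. *)
Lemma noether_constant x u psi0 psi lambda v t :
  extremal P x u psi0 psi lambda -> Omega P v -> t \in `[ta P, tb P] ->
  let G y := dot (psi y) (flow_ds (y, x y, v)).1.2 -
    Ham P y (x y) (u y) psi0 (psi y) lambda * (flow_ds (y, x y, v)).1.1 in
  G (ta P) = G t.
Proof.
move=> ex Ov tab G.
have [[[pu _ cx _] _ _ _ _] _ [cpsi _] _ [_ _ _ cH _]] := ex.
have e0 : `|0 : R| < eps by rewrite normr0.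
have cG : {within `[ta P, tb P], continuous G}.
  apply/subspace_continuousP => y yab.
  move: cx cpsi cH => /subspace_continuousP/(_ y yab) cx
    /subspace_continuousP/(_ y yab) cpsi /subspace_continuousP/(_ y yab) cH.
  have cz : (0 : R, (z, x z, v)) @[z --> within `[ta P, tb P]%classic (nbhs y)] -->
      (0 : R, (y, x y, v)).
    apply: cvg_pair_nbhs; first exact: cvg_cst.
    apply: cvg_pair_nbhs; last exact: cvg_cst.
    apply: cvg_pair_nbhs; last exact: cx.
    exact: cvg_within.
  have cd := cvg_comp _ _ cz ((F_C2.1 _ (domO (x y) v e0 yab)).2 (1, 0)).
  apply: cvgB; [apply: cvg_dot|apply: cvgM].
  - exact: cpsi.
  - exact: (cvg_comp _ _ cd (@continuous_snd_fst _ _ _ _ _)).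
  - exact: cH.
  - exact: (cvg_comp _ _ cd (@continuous_fst_fst _ _ _ _ _)).
have [[e eP] _ _] := pu.
have /andP[at_ tb_] : ta P <= t <= tb P by move: tab; rewrite in_itv.
apply: (@constant_of_derive0_finite R G e (ta P) t at_).
  apply: continuous_subspaceW cG => y /=; rewrite !in_itv /=.
  by move=> /andP[-> yt]; rewrite (le_trans yt tb_).
move=> y; rewrite in_itv /= => /andP[ay yt] ye.
have yab : y \in `]ta P, tb P[ by rewrite in_itv /= ay (lt_le_trans yt tb_).
apply: (noether_derive0 ex yab _ Ov).
exact: (eP y (subset_itv_oo_cc yab) ye).
Qed.

End Noether.

(** * The conservation law for the group [h] itself *)

Theorem theorem4p1 (R : realType) (n r k m : nat) (P : iso_problem R n r k m)
    (hab : ta P < tb P)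
    (hL : C1_on setT (Lagr P)) (hphi : C1_on setT (phi P))
    (hg : C1_on setT (giso P))
    (eps : R) (heps : 0 < eps)
    (h : R -> txu R n r -> txu R n r)
    (hgroup : C2_one_parameter_group (ta P) (tb P) eps h)
    (hOmega : respects_control_constraint P h)
    (hinv : invariant_under P eps h) :
  conservation_law P (fun t y v psi0 p lambda =>
    dot p (derive1 (fun s => Xcomp h t y v s) 0)
    - Ham P t y v psi0 p lambda * derive1 (fun s => Tcomp h t y v s) 0).
Proof.
move=> x u psi0 psi lambda ex.
have [smooth_h h0 _] := hgroup.
have [ O [F [oO DO FhE F_C2]]] := smooth_h.
have inD s t y v : `|s| < eps -> t \in `[ta P, tb P] ->
    [set q : R * txu R n r | `|q.1| < eps /\ ta P <= q.2.1.1 <= tb P]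
      (s, (t, y, v)).
  by move=> seps tab; split.
have domO s t y v : `|s| < eps -> t \in `[ta P, tb P] -> O (s, (t, y, v)).
  by move=> seps tab; apply: DO; exact: inD.
have FE s t y v : `|s| < eps -> t \in `[ta P, tb P] ->
    F (s, (t, y, v)) = h s (t, y, v).
  by move=> seps tab; apply: FhE; apply/mem_set; exact: inD.
have h0' t y v : t \in `[ta P, tb P] -> h 0 (t, y, v) = (t, y, v).
  by move=> tab; apply: h0.
have cp : control_pair P x u by have [[]] := ex.
have [_ uO _ _] := cp.
have aab : ta P \in `[ta P, tb P] by rewrite in_itv /= lexx ltW.
(* The control frozen in the generator is the initial value [u (ta P)]. *)
have Ov := uO _ aab.
have e0 : `|0 : R| < eps by rewrite normr0.
exists (dot (psi (ta P)) (flow_ds F (ta P, x (ta P), u (ta P))).1.2 -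
  Ham P (ta P) (x (ta P)) (u (ta P)) psi0 (psi (ta P)) lambda *
  (flow_ds F (ta P, x (ta P), u (ta P))).1.1) => t tab.
rewrite (noether_constant hab heps oO F_C2 domO FE h0' hOmega hinv hL hphi hg
  ex Ov tab).
rewrite -(flow_ds_control_indep hab heps F_C2 domO FE hinv cp tab Ov).
have dF := is_derive_flow_ds F_C2 domO (x t) (u t) e0 tab.
have near_h : \forall s \near (0 : R), F (s, (t, x t, u t)) = h s (t, x t, u t).
  by apply: filterS (near0_norm_lt heps) => s seps; exact: FE.
have -> : derive1 (fun s => Xcomp h t (x t) (u t) s) 0 =
    (flow_ds F (t, x t, u t)).1.2.
  rewrite derive1E; have [_ <-] := is_derive_snd_fst dF.
  by apply: near_eq_derive; apply: filterS near_h => s ->.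
have -> : derive1 (fun s => Tcomp h t (x t) (u t) s) 0 =
    (flow_ds F (t, x t, u t)).1.1.
  rewrite derive1E; have [_ <-] := is_derive_fst_fst dF.
  by apply: near_eq_derive; apply: filterS near_h => s ->.
by [].
Qed.
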